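(* Let $\mathcal{S}=\mathcal{S}_{\bar 0}\oplus\mathcal{S}_{\bar 1}$ be the $N=1$ super Schrödinger algebra in $(1+1)$-dimensional spacetime over $\mathbb{C}$. Then every local super-derivation $\Delta:\mathcal{S}\to\mathcal{S}$ is a super-derivation of $\mathcal{S}$.
   Context: The $N=1$ super Schrödinger algebra in $(1+1)$-dimensional spacetime is the 9-dimensional complex Lie superalgebra $\mathcal{S}=\mathcal{S}_{\bar 0}\oplus\mathcal{S}_{\bar 1}$ with even part $\mathcal{S}_{\bar 0}=\mathrm{span}_{\mathbb{C}}\{e,f,h,p,q,z\}$ and odd part $\mathcal{S}_{\bar 1}=\mathrm{span}_{\mathbb{C}}\{E,F,G\}$ (these nine elements form a basis) and brackets $[h,e]=2e$, $[h,f]=-2f$, $[e,f]=h$, $[h,p]=p$, $[h,q]=-q$, $[p,q]=z$, $[e,q]=p$, $[p,f]=-q$, $[h,E]=E$, $[h,F]=-F$, $[e,F]=-E$, $[f,E]=-F$, $[p,F]=G$, $[q,E]=G$, $[E,E]=2e$, $[F,F]=-2f$, $[G,G]=z$, $[E,F]=h$, $[E,G]=-p$, $[F,G]=q$; all other brackets of basis elements are either determined by graded skew-symmetry $[x,y]=-(-1)^{|x||y|}[y,x]$ or are zero. Here $|x|\in\{0,1\}$ is the degree of a homogeneous element $x$. A linear map $D:\mathcal{L}\to\mathcal{L}$ on a Lie superalgebra $\mathcal{L}$ that is homogeneous of degree $|D|=\alpha\in\mathbb{Z}_2$ (i.e. $D(\mathcal{L}_\beta)\subseteq\mathcal{L}_{\alpha+\beta}$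 for all $\beta\in\mathbb{Z}_2$) is a homogeneous super-derivation of degree $\alpha$ if $D([x,y])=[D(x),y]+(-1)^{|D||x|}[x,D(y)]$ for all homogeneous $x$ and all $y\in\mathcal{L}$. The set of these is $\mathrm{Der}_\alpha(\mathcal{L})$, and $\mathrm{Der}(\mathcal{L})=\mathrm{Der}_{\bar 0}(\mathcal{L})\oplus\mathrm{Der}_{\bar 1}(\mathcal{L})$; the elements of $\mathrm{Der}(\mathcal{L})$ are called super-derivations. A linear operator $\Delta:\mathcal{L}\to\mathcal{L}$ (not assumed homogeneous) is a local super-derivation if for every $x\in\mathcal{L}$ (not necessarily homogeneous) there is a super-derivation $D_x\in\mathrm{Der}(\mathcal{L})$, depending on $x$, with $\Delta(x)=D_x(x)$. *)

(* Defs.v *)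
From HB Require Import structures.
From mathcomp Require Import all_boot all_order all_algebra.
From mathcomp Require Import complex reals.

Set Implicit Arguments.
Unset Strict Implicit.
Unset Printing Implicit Defensive.

Import GRing.Theory.
Local Open Scope ring_scope.

(* Finite-dimensional Lie superalgebras in characteristic zero. Degrees in Z_2
   are booleans (false is even, true is odd), with addition (+) and product &&. *)
Record lieSuperalgebra (K : numFieldType) := LieSuperalgebra {
  superspace :> vectType K;
  superpart : bool -> {vspace superspace};
  superbracket : superspace -> superspace -> superspace;
  superpart_sum : (superpart false + superpart true)%VS = fullv;
  superpart_cap : (superpart false :&: superpart true)%VS = 0%VS;
  superbracket_linearl : forall y, linear (superbracket^~ y);
  superbracket_linearr : forall x, linear (superbracket x);
  superbracket_part : forall (a b : bool) x y,
    x \in superpart a -> y \in superpart b ->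
    superbracket x y \in superpart (a (+) b);
  superbracket_skew : forall (a b : bool) x y,
    x \in superpart a -> y \in superpart b ->
    superbracket x y = - ((-1) ^+ (a && b) *: superbracket y x);
  superbracket_jacobi : forall (a b : bool) x y w,
    x \in superpart a -> y \in superpart b ->
    superbracket x (superbracket y w) =
      superbracket (superbracket x y) w
      + (-1) ^+ (a && b) *: superbracket y (superbracket x w)
}.

Section SuperDerivations.

Variables (K : numFieldType) (L : lieSuperalgebra K).
Local Notation "[ x , y ]" := (superbracket x y).

Definition homogeneous_end (a : bool) (D : 'End(L)) : Prop :=
  forall (b : bool) x, x \in superpart L b -> D x \in superpart L (a (+) b).

Definition homogeneous_superderivation (a : bool) (D : 'End(L)) : Prop :=
  homogeneous_end a D /\
  forall (b : bool) (x y : L), x \in superpart L b ->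
    D [x, y] = [D x, y] + (-1) ^+ (a && b) *: [x, D y].

Definition superderivation (D : 'End(L)) : Prop :=
  exists D0 D1 : 'End(L),
    [/\ homogeneous_superderivation false D0,
        homogeneous_superderivation true D1 & D = D0 + D1].

Definition local_superderivation (Delta : 'End(L)) : Prop :=
  forall x : L, exists2 D : 'End(L), superderivation D & Delta x = D x.

End SuperDerivations.

Inductive schr_gen := ge | gf | gh | gp | gq | gz | gE | gF | gG.

Definition schr_gens : seq schr_gen := [:: ge; gf; gh; gp; gq; gz; gE; gF; gG].

Definition schr_code (a : schr_gen) : nat :=
  match a with
  | ge => 0 | gf => 1 | gh => 2 | gp => 3 | gq => 4 | gz => 5
  | gE => 6 | gF => 7 | gG => 8
  end.

Definition schr_index (a : schr_gen) : 'I_9 := inord (schr_code a).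

Definition schr_label (i : 'I_9) : schr_gen := nth ge schr_gens i.

Definition schr_parity (a : schr_gen) : bool :=
  match a with gE | gF | gG => true | _ => false end.

(* Some (c, g) stands for the value c g. Each nonzero bracket is listed
   in one order only. *)
Definition schr_table (a b : schr_gen) : option (int * schr_gen) :=
  match a, b with
  | gh, ge => Some (2, ge)
  | gh, gf => Some (-2, gf)
  | ge, gf => Some (1, gh)
  | gh, gp => Some (1, gp)
  | gh, gq => Some (-1, gq)
  | gp, gq => Some (1, gz)
  | ge, gq => Some (1, gp)
  | gp, gf => Some (-1, gq)
  | gh, gE => Some (1, gE)
  | gh, gF => Some (-1, gF)
  | ge, gF => Some (-1, gE)
  | gf, gE => Some (-1, gF)
  | gp, gF => Some (1, gG)
  | gq, gE => Some (1, gG)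
  | gE, gE => Some (2, ge)
  | gF, gF => Some (-2, gf)
  | gG, gG => Some (1, gz)
  | gE, gF => Some (1, gh)
  | gE, gG => Some (-1, gp)
  | gF, gG => Some (1, gq)
  | _, _ => None
  end.

(* Completion of the table by graded skew-symmetry, and by zero elsewhere. *)
Definition schr_const (a b : schr_gen) : int * schr_gen :=
  if schr_table a b is Some cg then cg
  else if schr_table b a is Some (c, g)
       then (- ((-1) ^+ (schr_parity a && schr_parity b) * c), g)
       else (0, ge).

Section Schroedinger.

Variable K : numFieldType.

Definition schr_vect (a : schr_gen) : 'rV[K]_9 := delta_mx 0 (schr_index a).

Definition schr_part (b : bool) : {vspace 'rV[K]_9} :=
  if b then <<[seq schr_vect a | a <- [:: gE; gF; gG]]>>%VS
  else <<[seq schr_vect a | a <- [:: ge; gf; gh; gp; gq; gz]]>>%VS.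

Definition schr_gen_bracket (a b : schr_gen) : 'rV[K]_9 :=
  (schr_const a b).1%:~R *: schr_vect (schr_const a b).2.

Definition schr_bracket (x y : 'rV[K]_9) : 'rV[K]_9 :=
  \sum_(i < 9) \sum_(j < 9)
     (x 0 i * y 0 j) *: schr_gen_bracket (schr_label i) (schr_label j).

Lemma schr_labelK (i : 'I_9) : schr_index (schr_label i) = i.
Proof.
apply: val_inj; rewrite /schr_index /schr_label.
by case: i; do 9?[case=> [|] //=; first by move=> ?; rewrite inordK].
Qed.

Lemma schr_indexK (a : schr_gen) : schr_label (schr_index a) = a.
Proof. by rewrite /schr_label /schr_index; case: a; rewrite inordK. Qed.

Lemma schr_indexE (a b : schr_gen) :
  (schr_index a == schr_index b) = (schr_code a == schr_code b).
Proof. by rewrite -val_eqE /= !inordK //; [case: b|case: a]. Qed.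

Lemma schr_all (P : pred schr_gen) : all P schr_gens -> forall a, P a.
Proof.
rewrite /= => /andP[? /andP[? /andP[? /andP[? /andP[? /andP[?]]]]]].
by case/andP=> ? /andP[? /andP[? _]]; case.
Qed.


Lemma schr_bracket_linearl y : linear (schr_bracket^~ y).
Proof.
move=> c u v; rewrite /schr_bracket scaler_sumr -big_split; apply: eq_bigr => i _.
rewrite scaler_sumr -big_split; apply: eq_bigr => j _ /=.
by rewrite !mxE scalerA -scalerDl mulrDl mulrA.
Qed.

Lemma schr_bracket_linearr x : linear (schr_bracket x).
Proof.
move=> c u v; rewrite /schr_bracket scaler_sumr -big_split; apply: eq_bigr => i _.
rewrite scaler_sumr -big_split; apply: eq_bigr => j _ /=.
by rewrite !mxE scalerA -scalerDl mulrDr mulrCA.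
Qed.

Lemma schr_bracket_vect (a b : schr_gen) :
  schr_bracket (schr_vect a) (schr_vect b) = schr_gen_bracket a b.
Proof.
rewrite /schr_bracket (bigD1 (schr_index a)) //= (bigD1 (schr_index b)) //=.
rewrite !mxE !eqxx mulr1 scale1r !schr_indexK.
rewrite big1 ?addr0 => [|j /negPf nj]; last first.
  by rewrite !mxE nj andbF mulr0 scale0r.
rewrite big1 ?addr0 // => i /negPf ni; apply: big1 => j _.
by rewrite !mxE ni andbF mul0r scale0r.
Qed.

Lemma schr_part_ind (b : bool) (P : 'rV[K]_9 -> Prop) :
    P 0 -> (forall c u v, P u -> P v -> P (c *: u + v)) ->
    (forall a, schr_parity a = b -> P (schr_vect a)) ->
  forall x, x \in schr_part b -> P x.
Proof.
move=> P0 PD Pv.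
have aux s : all (fun a => schr_parity a == b) s ->
    forall x, x \in <<[seq schr_vect a | a <- s]>>%VS -> P x.
  elim: s => [_ x|a s IHs /= /andP[/eqP sa sb] x].
    by rewrite span_nil memv0 => /eqP->.
  rewrite span_cons => /memv_addP[_ /vlineP[c ->] [v sv ->]].
  by apply: PD; [apply: Pv | apply: IHs sv].
by rewrite /schr_part; case: b Pv aux => Pv aux x; apply: aux.
Qed.

Lemma schr_vect_part a : schr_vect a \in schr_part (schr_parity a).
Proof.
case: a; apply: memv_span => /=; rewrite !inE eqxx ?orbT //.
Qed.

Lemma schr_vect_sum (x : 'rV[K]_9) :
  x = \sum_(i < 9) x 0 i *: schr_vect (schr_label i).
Proof.
rewrite [LHS]row_sum_delta; apply: eq_bigr => i _.
by rewrite /schr_vect schr_labelK.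
Qed.

Lemma schr_vect_ind (P : 'rV[K]_9 -> Prop) :
    P 0 -> (forall c u v, P u -> P v -> P (c *: u + v)) ->
    (forall a, P (schr_vect a)) ->
  forall x, P x.
Proof.
move=> P0 PD Pv x; rewrite (schr_vect_sum x).
by elim/big_rec: _ => // i y _ Py; apply: PD.
Qed.

Lemma schr_part_sum : (schr_part false + schr_part true)%VS = fullv.
Proof.
apply/eqP; rewrite eqEsubv subvf; apply/subvP => x _; elim/schr_vect_ind: x.
- exact: mem0v.
- by move=> c u v hu hv; rewrite memvD // memvZ.
move=> a; have := schr_vect_part a; case: (schr_parity a).
  exact/subvP/addvSr.
exact/subvP/addvSl.
Qed.

Lemma schr_part_coord (b : bool) x (a : schr_gen) :
  x \in schr_part b -> schr_parity a != b -> x 0 (schr_index a) = 0.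
Proof.
move=> xb ab; elim/schr_part_ind: xb.
- by rewrite mxE.
- by move=> c u v hu hv; rewrite !mxE hu hv mulr0 addr0.
move=> a' a'b; rewrite mxE eqxx schr_indexE /=.
by case: eqP => // eqc; case/negP: ab; rewrite -a'b; move: eqc; case: (a); case: (a').
Qed.

Lemma schr_part_cap : (schr_part false :&: schr_part true)%VS = 0%VS.
Proof.
apply/eqP; rewrite -subv0; apply/subvP => x; rewrite memv_cap => /andP[x0 x1].
rewrite memv0; apply/eqP/rowP => i; rewrite [RHS]mxE -(schr_labelK i).
case ab: (schr_parity (schr_label i)).
  by apply: schr_part_coord x0 _; rewrite ab.
by apply: schr_part_coord x1 _; rewrite ab.
Qed.

Lemma schr_bracketDZl c u v y :
  schr_bracket (c *: u + v) y = c *: schr_bracket u y + schr_bracket v y.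
Proof. exact: schr_bracket_linearl. Qed.

Lemma schr_bracketDZr c u v x :
  schr_bracket x (c *: u + v) = c *: schr_bracket x u + schr_bracket x v.
Proof. exact: schr_bracket_linearr. Qed.

Lemma schr_bracket0r x : schr_bracket x 0 = 0.
Proof. by have := schr_bracketDZr (-1) 0 0 x; rewrite !scaleN1r !addNr. Qed.

Lemma schr_bracket0l x : schr_bracket 0 x = 0.
Proof. by have := schr_bracketDZl (-1) 0 0 x; rewrite !scaleN1r !addNr. Qed.

Definition schr_bracketE :=
  (schr_bracketDZl, schr_bracketDZr, schr_bracket0l, schr_bracket0r).

Lemma schr_bracketZr c x y : schr_bracket x (c *: y) = c *: schr_bracket x y.
Proof. by rewrite -[c *: y]addr0 !schr_bracketE addr0. Qed.

Lemma schr_bracketZl c x y : schr_bracket (c *: x) y = c *: schr_bracket x y.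
Proof. by rewrite -[c *: x]addr0 !schr_bracketE addr0. Qed.

Lemma schr_bracket_part (a b : bool) x y :
  x \in schr_part a -> y \in schr_part b -> schr_bracket x y \in schr_part (a (+) b).
Proof.
move=> xa yb; elim/schr_part_ind: xa.
- by rewrite schr_bracketE mem0v.
- by move=> c u v hu hv; rewrite schr_bracketE memvD // memvZ.
move=> g ga; elim/schr_part_ind: yb.
- by rewrite schr_bracketE mem0v.
- by move=> c u v hu hv; rewrite schr_bracketE memvD // memvZ.
move=> g' gb; rewrite schr_bracket_vect -ga -gb /schr_gen_bracket.
have : ((schr_const g g').1 == 0)
       || (schr_parity (schr_const g g').2 == schr_parity g (+) schr_parity g').
  by case: (g); case: (g').
by case/orP=> /eqP h; [rewrite h scale0r mem0v | rewrite memvZ // -h schr_vect_part].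
Qed.

Lemma schr_vectE n a (i : 'I_9) :
  (n%:~R *: schr_vect a) 0 i
    = (n * (schr_code a == schr_code (schr_label i))%:R)%:~R :> K.
Proof. by rewrite !mxE -{1}(schr_labelK i) eq_sym schr_indexE rmorphM rmorph_nat. Qed.

Lemma schr_bracket_skew (a b : bool) x y :
  x \in schr_part a -> y \in schr_part b ->
  schr_bracket x y = - ((-1) ^+ (a && b) *: schr_bracket y x).
Proof.
move=> xa yb; elim/schr_part_ind: xa.
- by rewrite !schr_bracketE scaler0 oppr0.
- move=> c u v hu hv; rewrite !schr_bracketE hu hv.
  by rewrite scalerDr opprD scalerN !scalerA mulrC.
move=> g ga; elim/schr_part_ind: yb.
- by rewrite !schr_bracketE scaler0 oppr0.
- move=> c u v hu hv; rewrite !schr_bracketE hu hv.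
  by rewrite scalerDr opprD scalerN !scalerA mulrC.
move=> g' gb; rewrite !schr_bracket_vect -ga -gb /schr_gen_bracket.
rewrite -scaleNr scalerA -(rmorph_sign (intmul 1)) -!rmorphN -rmorphM /=.
apply/rowP=> i; rewrite !schr_vectE; congr (_%:~R); apply/eqP.
move: (schr_label i) => k; move: k; apply: schr_all; move: g' {gb}; apply: schr_all.
by move: g {ga}; apply: schr_all; vm_compute.
Qed.

Lemma schr_bracket_jacobi (a b : bool) x y w :
  x \in schr_part a -> y \in schr_part b ->
  schr_bracket x (schr_bracket y w) =
    schr_bracket (schr_bracket x y) w
    + (-1) ^+ (a && b) *: schr_bracket y (schr_bracket x w).
Proof.
move=> xa yb; elim/schr_part_ind: xa.
- by rewrite !schr_bracketE scaler0 addr0.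
- move=> c u v hu hv; rewrite !schr_bracketE hu hv !scalerDr !scalerA.
  by rewrite [c * _]mulrC addrACA.
move=> g ga; elim/schr_part_ind: yb.
- by rewrite !schr_bracketE scaler0 addr0.
- move=> c u v hu hv; rewrite !schr_bracketE hu hv !scalerDr !scalerA.
  by rewrite [c * _]mulrC addrACA.
move=> g' gb; elim/schr_vect_ind: w.
- by rewrite !schr_bracketE scaler0 addr0.
- move=> c u v hu hv; rewrite !schr_bracketE hu hv !scalerDr !scalerA.
  by rewrite [c * _]mulrC addrACA.
move=> g'' ; rewrite -ga -gb.
rewrite !schr_bracket_vect /schr_gen_bracket !schr_bracketZl !schr_bracketZr.
rewrite !schr_bracket_vect /schr_gen_bracket !scalerA.
rewrite -(rmorph_sign (intmul 1)) -!rmorphM /=.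
apply/rowP=> i; rewrite [RHS]mxE !schr_vectE -rmorphD /=; congr (_%:~R); apply/eqP.
move: (schr_label i) => k; move: k; apply: schr_all; move: g''; apply: schr_all.
by move: g' {gb}; apply: schr_all; move: g {ga}; apply: schr_all; vm_compute.
Qed.

Definition superSchroedinger : lieSuperalgebra K :=
  LieSuperalgebra schr_part_sum schr_part_cap schr_bracket_linearl
    schr_bracket_linearr schr_bracket_part schr_bracket_skew
    schr_bracket_jacobi.

End Schroedinger.

(* Main.v *)
(* Splitting an endomorphism D into its even and odd components, the super
   Leibniz rules say that the 81 entries of D satisfy an explicit system of 729
   linear equations with integer coefficients. If D is a local super-derivation,
   x a vector and phi a linear form vanishing on D'(x) for every super-derivation
   D', then phi(D(x)) = 0. Seventy-two such pairs (x, phi) suffice: the rank one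
   equations phi(D(x)) = 0 span the same space as the Leibniz equations, and both
   inclusions are decided by a fraction-free Gaussian elimination. *)

From HB Require Import structures.
Require Import Defs.
From mathcomp Require Import all_boot all_order all_algebra.
From mathcomp Require Import complex reals.

Set Implicit Arguments.
Unset Strict Implicit.
Unset Printing Implicit Defensive.

Import GRing.Theory.
Local Open Scope ring_scope.

(** * The generators as a finite type *)

Lemma schr_codeK : cancel schr_code (nth ge schr_gens).
Proof. by case. Qed.

HB.instance Definition _ := Countable.copy schr_gen (can_type schr_codeK).

Lemma schr_gens_enum : Finite.axiom schr_gens.
Proof. by case. Qed.

HB.instance Definition _ := isFinite.Build schr_gen schr_gens_enum.

(** * Fraction-free Gaussian elimination on integer rows *)

Section Elimination.

Variable K : numFieldType.
Implicit Types (r s : seq int) (v : seq K).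

Fixpoint dot r v : K :=
  if r is c :: r' then if v is x :: v' then c%:~R * x + dot r' v' else 0 else 0.

(** The shorter row is padded with zeros. Since [dot] stops at the shorter list, [dot_lincomb] then
    holds for rows of any lengths. *)
Fixpoint row_lincomb (a : int) r (b : int) s : seq int :=
  match r, s with
  | c :: r', d :: s' => (a * c + b * d) :: row_lincomb a r' b s'
  | [::], _ => [seq b * d | d <- s]
  | _, [::] => [seq a * c | c <- r]
  end.

(** The pivot is the first nonzero entry of [r]. Cross-multiplying by it instead of dividing clears
    the pivot column of [s] and keeps all entries integral. *)
Definition eliminate r s : seq int :=
  let p := find (predC1 0) r in
  if s`_p == 0 then s else row_lincomb r`_p s (- s`_p) r.

(* Sound but fuelled by [n]: rows not used when [n] reaches 0 are dropped. *)
Fixpoint entails n (rows goals : seq (seq int)) : bool :=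
  if n is n'.+1 then
    if rows is r :: rows' then
      if all (pred1 0) r then entails n' rows' goals
      else entails n' (map (eliminate r) rows') (map (eliminate r) goals)
    else all (all (pred1 0)) goals
  else all (all (pred1 0)) goals.

Lemma dot_scale a r v : dot [seq a * c | c <- r] v = a%:~R * dot r v.
Proof.
elim: r v => [|c r IHr] [|x v] /=; rewrite ?mulr0 //.
by rewrite IHr rmorphM mulrDr mulrA.
Qed.

Lemma dot_lincomb a r b s v :
  dot (row_lincomb a r b s) v = a%:~R * dot r v + b%:~R * dot s v.
Proof.
elim: r s v => [|c r IHr] [|d s] [|x v]; rewrite /= ?mulr0 ?addr0 ?add0r //.
- by rewrite dot_scale rmorphM mulrDr mulrA.
- by rewrite dot_scale rmorphM mulrDr mulrA.
by rewrite IHr rmorphD !rmorphM /= mulrDl !mulrDr !mulrA addrACA.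
Qed.

Lemma dot_zero r v : all (pred1 0) r -> dot r v = 0.
Proof.
elim: r v => [|c r IHr] [|x v] //= /andP[/eqP-> /IHr->].
by rewrite mul0r addr0.
Qed.

(** In characteristic zero the nonzero integer pivot stays nonzero in [K], so the scaling can be
    undone. One direction serves the goals, the other the remaining rows. *)
Lemma dot_eliminate r s v : ~~ all (pred1 0) r -> dot r v = 0 ->
  dot (eliminate r s) v = 0 <-> dot s v = 0.
Proof.
move=> r_neq0 rv; rewrite /eliminate; case: eqP => // _.
rewrite dot_lincomb rv mulr0 addr0; split=> [/eqP|->]; last exact: mulr0.
rewrite mulf_eq0 intr_eq0 => /orP[|/eqP//].
rewrite -has_predC in r_neq0.
by have /= /negPf-> := nth_find 0 r_neq0.
Qed.

(** Modulo a pivot row that vanishes on [v], reducing a row or a goal gives an equivalent equation.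
    Dropping rows only weakens the hypotheses, and success is reported only when every goal has been
    reduced to zero. *)
Lemma entailsP n rows goals v : entails n rows goals ->
  (forall r, r \in rows -> dot r v = 0) -> forall r, r \in goals -> dot r v = 0.
Proof.
have done_ok (gs : seq (seq int)) : all (all (pred1 0)) gs ->
    forall r, r \in gs -> dot r v = 0.
  by move=> /allP gs0 r /gs0; apply: dot_zero.
elim: n rows goals => [|n IHn] [|r rows] goals /=; try by move=> /done_ok.
have in_rows s : s \in rows -> s \in r :: rows by rewrite inE orbC => ->.
case: ifP => [_|/negbT r_neq0] rows_ok rows0.
  by apply: IHn rows_ok _ => s /in_rows; apply: rows0.
have rv : dot r v = 0 by apply: rows0; rewrite mem_head.
move=> s s_goal; apply/(dot_eliminate s r_neq0 rv).
apply: IHn rows_ok _ _ (map_f _ s_goal) => _ /mapP[t /in_rows t_row ->].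
by apply/(dot_eliminate t r_neq0 rv)/rows0.
Qed.

Lemma dot_map (T : Type) (e : seq T) (f : T -> int) (g : T -> K) :
  dot (map f e) (map g e) = \sum_(i <- e) (f i)%:~R * g i.
Proof. by elim: e => [|i e IHe]; rewrite ?big_nil ?big_cons //= IHe. Qed.

End Elimination.

(** * Integer rows of the Leibniz equations and of the tests *)

Definition schr_pairs := [seq (a, k) | a <- schr_gens, k <- schr_gens].

Definition schr_struct (a b k : schr_gen) : int :=
  ((schr_const a b).2 == k)%:Z * (schr_const a b).1.

(* Entry [m = (g, l)] stands for the coefficient of [l] in [D g]. *)
Definition leibniz_form (a b k : schr_gen) (m : schr_gen * schr_gen) : int :=
  (m.2 == k)%:Z * schr_struct a b m.1 - (m.1 == a)%:Z * schr_struct m.2 b k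
  - (m.1 == b)%:Z * ((-1) ^+ (schr_parity a
       && (schr_parity a (+) schr_parity b (+) schr_parity k))
     * schr_struct a m.2 k).

Definition lincomb := seq (int * schr_gen).

Definition lincomb_coef (x : lincomb) (a : schr_gen) : int :=
  foldr (fun cg n => (cg.2 == a)%:Z * cg.1 + n) 0 x.

(** For [t = (x, phi)] these are the coefficients of the form sending [D] to [phi (D x)]. *)
Definition rank1_form (t : lincomb * lincomb) (m : schr_gen * schr_gen) : int :=
  lincomb_coef t.1 m.1 * lincomb_coef t.2 m.2.

(* [(g, s)] lists in [s] the coordinates of [D g] that vanish for every
   super-derivation [D]. *)
Definition schr_zero_entries : seq (schr_gen * seq schr_gen) :=
  [:: (ge, [:: gf; gq; gz; gF; gG]);
    (gf, [:: ge; gp; gz; gE; gG]);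
    (gh, [:: gh; gz; gG]);
    (gp, [:: ge; gf; gh; gE; gF]);
    (gq, [:: ge; gf; gh; gE; gF]);
    (gz, [:: ge; gf; gh; gp; gq; gE; gF; gG]);
    (gE, [:: gf; gq; gz]);
    (gF, [:: ge; gp; gz]);
    (gG, [:: ge; gf; gh; gE; gF])].

(* The pairs (x, phi), found by a computer search over vectors [x] with few small
   integer coordinates. *)
Definition schr_tests : seq (lincomb * lincomb) :=
  [seq ([:: (1, ak.1)], [:: (1, k)]) | ak <- schr_zero_entries, k <- ak.2] ++ [::
  ([:: (1, ge); (1, gf)], [:: (1, ge); (1, gf)]);
  ([:: (1, ge); (1, gp)], [:: (1, gh); (1, gq)]);
  ([:: (1, ge); (1, gp)], [:: (1, gE); (1, gG)]);
  ([:: (1, ge); (1, gG)], [:: (-1, gq); (1, gE)]);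
  ([:: (1, gf); (1, gq)], [:: (-1, gh); (1, gp)]);
  ([:: (1, gf); (1, gq)], [:: (1, gF); (1, gG)]);
  ([:: (1, gf); (1, gG)], [:: (1, gp); (1, gF)]);
  ([:: (1, gh); (1, gp)], [:: (1, gF); (1, gG)]);
  ([:: (1, gh); (1, gq)], [:: (-1, gE); (1, gG)]);
  ([:: (1, gh); (1, gE)], [:: (-1, gq); (1, gG)]);
  ([:: (1, gh); (1, gF)], [:: (1, gp); (1, gG)]);
  ([:: (1, gp); (1, gE)], [:: (1, gq); (1, gF)]);
  ([:: (1, gq); (1, gF)], [:: (1, gp); (1, gE)]);
  ([:: (1, gE); (1, gF)], [:: (1, gp); (1, gq)]);
  ([:: (1, gE); (1, gG)], [:: (-1, gh); (1, gq)]);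
  ([:: (1, gF); (1, gG)], [:: (1, gh); (1, gp)]);
  ([:: (1, ge); (1, gh)], [:: (1, gf); (2, gh)]);
  ([:: (1, ge); (1, gF)], [:: (1, ge); (2, gF)]);
  ([:: (1, gf); (1, gh)], [:: (1, ge); (2, gh)]);
  ([:: (1, gf); (1, gE)], [:: (1, gf); (2, gE)]);
  ([:: (1, gp); (1, gE)], [:: (1, gh); (1, gz); (1, gG)]);
  ([:: (1, gq); (1, gF)], [:: (1, gh); (-1, gz); (1, gG)]);
  ([:: (1, ge); (-1, gf); (1, gh)], [:: (1, gp); (1, gq)]);
  ([:: (1, ge); (-1, gf); (-1, gh)], [:: (-1, gp); (1, gq)]);
  ([:: (1, gE); (1, gF)], [:: (-1, ge); (1, gf); (2, gh)]);
  ([:: (1, gE); (-1, gF)], [:: (1, ge); (-1, gf); (2, gh)]);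
  ([:: (1, gE); (1, gG)], [:: (1, ge); (2, gp); (2, gz)]);
  ([:: (1, ge); (2, gp); (2, gz)], [:: (2, ge); (-2, gp); (1, gz)]);
  ([:: (1, gf); (2, gq); (-2, gz)], [:: (-2, gf); (2, gq); (1, gz)]);
  ([:: (1, gh); (-1, gp); (1, gF); (1, gG)],
   [:: (1, gh); (1, gp); (-1, gF); (1, gG)])].

Definition leibniz_row (a b k : schr_gen) : seq int :=
  map (leibniz_form a b k) schr_pairs.

Definition leibniz_rows : seq (seq int) :=
  [seq leibniz_row ab.1 ab.2 k | ab <- schr_pairs, k <- schr_gens].

Definition test_rows : seq (seq int) :=
  [seq map (rank1_form t) schr_pairs | t <- schr_tests].

(** Every test form vanishes on all super-derivations. Each row costs one unit of fuel, and there
    are 81 * 9 = 729 Leibniz rows. *)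
Lemma leibniz_entails_tests : entails 729 leibniz_rows test_rows.
Proof. by vm_compute. Qed.

(** Conversely, the 72 test equations force the Leibniz rule. *)
Lemma tests_entail_leibniz : entails 72 test_rows leibniz_rows.
Proof. by vm_compute. Qed.

(** * Even and odd components of an endomorphism *)

Section Grading.

Variables (K : numFieldType) (L : lieSuperalgebra K).
Implicit Types (a b c : bool) (D : 'End(L)) (x y u : L).

Definition superproj c : 'End(L) :=
  daddv_pi (superpart L c) (superpart L (~~ c)).

(** For the grading, [a = false] keeps the two diagonal blocks of [D] and [a = true] the two
    off-diagonal ones. *)
Definition supercomponent D a : 'End(L) :=
  ((superproj (a (+) false) \o D \o superproj false)
   + (superproj (a (+) true) \o D \o superproj true))%VF.

Lemma superpart_capC c : (superpart L c :&: superpart L (~~ c))%VS = 0%VS.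
Proof. by case: c => /=; [rewrite capvC|]; exact: superpart_cap. Qed.

Lemma superproj_part c x : superproj c x \in superpart L c.
Proof. exact: memv_pi. Qed.

Lemma superproj_id c x : x \in superpart L c -> superproj c x = x.
Proof. exact/daddv_pi_id/superpart_capC. Qed.

Lemma superprojD c x : superproj c x + superproj (~~ c) x = x.
Proof.
rewrite /superproj negbK; apply: daddv_pi_add; first exact: superpart_capC.
by case: c => /=; [rewrite addvC|]; rewrite superpart_sum memvf.
Qed.

Lemma superproj_eq0 c x : x \in superpart L (~~ c) -> superproj c x = 0.
Proof.
move=> xc; apply: (@addIr _ (superproj (~~ c) x)).
by rewrite superprojD add0r superproj_id.
Qed.

Lemma supercomponentE D a b x : x \in superpart L b ->
  supercomponent D a x = superproj (a (+) b) (D x).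
Proof.
rewrite /supercomponent add_lfunE !comp_lfunE; case: b => xb.
  by rewrite (@superproj_eq0 false) // !linear0 add0r (superproj_id xb).
by rewrite (@superproj_eq0 true) // !linear0 addr0 (superproj_id xb).
Qed.

Lemma supercomponent_homogeneous D a : homogeneous_end a (supercomponent D a).
Proof. by move=> b x xb; rewrite (supercomponentE _ _ xb) superproj_part. Qed.

Lemma supercomponentD D : D = supercomponent D false + supercomponent D true.
Proof.
apply/lfunP => x; rewrite add_lfunE -(superprojD false x) !linearD /=.
rewrite !(supercomponentE _ _ (superproj_part _ _)) /=.
by rewrite addrACA !superprojD.
Qed.

End Grading.

(** * Coordinates in the basis of generators *)

Section Coordinates.

Variable K : numFieldType.
Local Notation S := (superSchroedinger K).
Local Notation proj := (@superproj K S).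
Implicit Types (x y u v : 'rV[K]_9) (D : 'End(S)) (g k : schr_gen).

Definition coord x k : K := x 0 (schr_index k).

Definition entry D (m : schr_gen * schr_gen) : K :=
  coord (D (schr_vect K m.1)) m.2.

Lemma coordD x y k : coord (x + y) k = coord x k + coord y k.
Proof. by rewrite /coord mxE. Qed.

Lemma coordZ c x k : coord (c *: x) k = c * coord x k.
Proof. by rewrite /coord mxE. Qed.

Lemma coord_sum (I : Type) (r : seq I) (f : I -> 'rV[K]_9) k :
  coord (\sum_(i <- r) f i) k = \sum_(i <- r) coord (f i) k.
Proof. by rewrite /coord summxE. Qed.

Lemma coord_inj x y : (forall k, coord x k = coord y k) -> x = y.
Proof. by move=> xy; apply/rowP => i; rewrite -(schr_labelK i); apply: xy. Qed.

Lemma coord_vect g k : coord (schr_vect K g) k = (g == k)%:R.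
Proof. by rewrite /coord !mxE schr_indexE eqxx eq_sym. Qed.

Lemma coord_expand x : x = \sum_g coord x g *: schr_vect K g.
Proof.
apply: coord_inj => k; rewrite coord_sum (bigD1 k) //= coordZ coord_vect eqxx mulr1.
by rewrite big1 ?addr0 // => g /negPf gk; rewrite coordZ coord_vect gk mulr0.
Qed.

Lemma coord_gen_bracket g g' k :
  coord (schr_gen_bracket K g g') k = (schr_struct g g' k)%:~R.
Proof.
rewrite /schr_gen_bracket coordZ coord_vect /schr_struct rmorphM mulrC /=.
by rewrite -pmulrn.
Qed.

Lemma coord_bracketl x g k : coord (schr_bracket x (schr_vect K g)) k
  = \sum_g' (schr_struct g' g k)%:~R * coord x g'.
Proof.
rewrite {1}(coord_expand x).
rewrite (big_morph (fun u => schr_bracket u (schr_vect K g))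
  (id1 := 0) (op1 := +%R)); last 2 first.
- by move=> u v; have := schr_bracketDZl 1 u v (schr_vect K g); rewrite !scale1r.
- exact: schr_bracket0l.
rewrite coord_sum; apply: eq_bigr => g' _.
by rewrite schr_bracketZl coordZ schr_bracket_vect coord_gen_bracket mulrC.
Qed.

Lemma coord_bracketr x g k : coord (schr_bracket (schr_vect K g) x) k
  = \sum_g' (schr_struct g g' k)%:~R * coord x g'.
Proof.
rewrite {1}(coord_expand x).
rewrite (big_morph (schr_bracket (schr_vect K g))
  (id1 := 0) (op1 := +%R)); last 2 first.
- by move=> u v; have := schr_bracketDZr 1 u v (schr_vect K g); rewrite !scale1r.
- exact: schr_bracket0r.
rewrite coord_sum; apply: eq_bigr => g' _.
by rewrite schr_bracketZr coordZ schr_bracket_vect coord_gen_bracket mulrC.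
Qed.

Lemma coord_part0 b x k : x \in superpart S b -> schr_parity k != b -> coord x k = 0.
Proof. exact: schr_part_coord. Qed.

Lemma gen_part g : schr_vect K g \in superpart S (schr_parity g).
Proof. exact: schr_vect_part. Qed.

(* The sign is the one of the homogeneous component of [D] that contributes to
   the coordinate [k]; this merges the Leibniz rules of both components. *)
Definition leibniz_eq D g g' k : Prop :=
  coord (D (schr_bracket (schr_vect K g) (schr_vect K g'))) k =
    coord (schr_bracket (D (schr_vect K g)) (schr_vect K g')) k
    + (-1) ^+ (schr_parity g
        && (schr_parity g (+) schr_parity g' (+) schr_parity k))
      * coord (schr_bracket (schr_vect K g) (D (schr_vect K g'))) k.

(** * Super-derivations as solutions of the Leibniz equations *)

Definition superderivation_on_gens a D : Prop :=
  forall g g', D (schr_bracket (schr_vect K g) (schr_vect K g')) =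
    schr_bracket (D (schr_vect K g)) (schr_vect K g')
    + (-1) ^+ (a && schr_parity g)
      *: schr_bracket (schr_vect K g) (D (schr_vect K g')).

(** The sign is constant while [x] stays in one graded part, so both sides are linear in [x] there
    and linear in [y]. *)
Lemma superderivation_gens a D : homogeneous_end a D ->
  superderivation_on_gens a D -> homogeneous_superderivation a D.
Proof.
move=> Da Dg; split=> // b x y; rewrite /= => xb.
elim/schr_part_ind: xb => [|c u v hu hv|g gb].
- by rewrite !linear0 !schr_bracketE linear0 scaler0 addr0.
- rewrite !linearP !schr_bracketE linearP /= hu hv.
  by rewrite !scalerDr !scalerA [c * _]mulrC addrACA.
elim/schr_vect_ind: y => [|c u v hu hv|g'].
- by rewrite !linear0 !schr_bracketE linear0 scaler0 addr0.
- rewrite !linearP !schr_bracketE linearP /= hu hv.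
  by rewrite !scalerDr !scalerA [c * _]mulrC addrACA.
by rewrite Dg gb.
Qed.

Lemma homogeneous_leibniz a D g g' k : homogeneous_superderivation a D ->
  leibniz_eq D g g' k.
Proof.
move=> [Da DL]; rewrite /leibniz_eq.
have gP := gen_part g; have gP' := gen_part g'.
have Dg : superderivation_on_gens a D by move=> h h'; apply: DL (gen_part h).
rewrite Dg coordD coordZ; congr (_ + _).
(* By grading, the last term has a [k] coordinate only if [a] is the sum of the parities of [g],
   [g'] and [k]. In that case the two signs agree; otherwise the term is zero. *)
have [kP|kP] := eqVneq (schr_parity k) (schr_parity g (+) (a (+) schr_parity g')).
  rewrite kP; congr (_ ^+ _ * _).
  by case: (a); case: (schr_parity g); case: (schr_parity g').
have /= r0 := coord_part0 (superbracket_part gP (Da _ _ gP')) kP.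
by rewrite r0 !mulr0.
Qed.

(** The sign in [leibniz_eq] depends only on [g], [g'], [k], so even and odd solutions can be
    added. *)
Lemma leibniz_eqD D D' g g' k :
  leibniz_eq D g g' k -> leibniz_eq D' g g' k -> leibniz_eq (D + D') g g' k.
Proof.
rewrite /leibniz_eq !add_lfunE => DE DE'.
have addl u v y : schr_bracket (u + v) y = schr_bracket u y + schr_bracket v y.
  by have := schr_bracketDZl 1 u v y; rewrite !scale1r.
have addr u v y : schr_bracket y (u + v) = schr_bracket y u + schr_bracket y v.
  by have := schr_bracketDZr 1 u v y; rewrite !scale1r.
by rewrite addl addr !coordD DE DE' mulrDr addrACA.
Qed.

Lemma superderivation_leibniz D g g' k : superderivation D -> leibniz_eq D g g' k.
Proof.
move=> [D0 [D1 [D0P D1P ->]]].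
by apply: leibniz_eqD; [move: D0P | move: D1P]; apply: homogeneous_leibniz.
Qed.

Lemma coord_superproj c x k :
  coord (proj c x) k = if schr_parity k == c then coord x k else 0.
Proof.
case: ifPn => [/eqP kc|]; last exact/coord_part0/superproj_part.
rewrite -[in RHS](@superprojD K S c x) coordD.
rewrite (@coord_part0 (~~ c) (proj (~~ c) x)) ?addr0 //.
  exact: superproj_part.
by rewrite kc; case: (c).
Qed.

(** The complementary part of [x] brackets with [g] into the parity opposite to that of [k]. *)
Lemma coord_bracket_superproj c x g k : schr_parity k = schr_parity g (+) c ->
  coord (schr_bracket (schr_vect K g) (proj c x)) k =
    coord (schr_bracket (schr_vect K g) x) k
  /\ coord (schr_bracket (proj c x) (schr_vect K g)) k =
    coord (schr_bracket x (schr_vect K g)) k.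
Proof.
move=> kP; have gP := gen_part g; have xP := @superproj_part K S (~~ c) x.
have neq : schr_parity k != schr_parity g (+) ~~ c.
  by rewrite kP; case: (schr_parity g); case: (c).
have neq' : schr_parity k != ~~ c (+) schr_parity g by rewrite addbC.
have /= r0 := coord_part0 (superbracket_part gP xP) neq.
have /= l0 := coord_part0 (superbracket_part xP gP) neq'.
have := schr_bracketDZl 1 (proj c x) (proj (~~ c) x) (schr_vect K g).
have := schr_bracketDZr 1 (proj c x) (proj (~~ c) x) (schr_vect K g).
rewrite !scale1r => Er El.
by split; rewrite -[in RHS](@superprojD K S c x) ?Er ?El coordD ?r0 ?l0 addr0.
Qed.

(** Coordinate [k] of the rule on [g], [g'] sees only one homogeneous component of [D]; for the
    other component the rule at [k] reads 0 = 0. *)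
Lemma leibniz_superderivation D :
  (forall g g' k, leibniz_eq D g g' k) -> superderivation D.
Proof.
move=> DE.
have Dg a : superderivation_on_gens a (supercomponent D a).
  move=> g g'; apply: coord_inj => k.
  have gP := gen_part g; have gP' := gen_part g'.
  have bP := superbracket_part gP gP'.
  have hD := @supercomponent_homogeneous K S D a.
  rewrite coordD coordZ.
  have [kP|kP] := eqVneq (schr_parity k) (a (+) (schr_parity g (+) schr_parity g')).
    have kl : schr_parity k = schr_parity g' (+) (a (+) schr_parity g).
      by rewrite kP addbA addbC.
    have kr : schr_parity k = schr_parity g (+) (a (+) schr_parity g').
      by rewrite kP addbCA.
    have [_ l] := coord_bracket_superproj (D (schr_vect K g)) kl.
    have [r _] := coord_bracket_superproj (D (schr_vect K g')) kr.
    rewrite (supercomponentE _ _ bP) (supercomponentE _ _ gP).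
    rewrite (supercomponentE _ _ gP').
    rewrite coord_superproj kP eqxx l r.
    have := DE g g' k; rewrite /leibniz_eq kP /= => ->; congr (_ + _ ^+ _ * _).
    by case: (a); case: (schr_parity g); case: (schr_parity g').
  (* In the remaining parity all three terms lie in the part not containing [k]. *)
  have kl : schr_parity k != (a (+) schr_parity g) (+) schr_parity g'.
    by rewrite -addbA.
  have kr : schr_parity k != schr_parity g (+) (a (+) schr_parity g').
    by rewrite addbCA.
  have /= -> := coord_part0 (hD _ _ bP) kP.
  have /= -> := coord_part0 (superbracket_part (hD _ _ gP) gP') kl.
  have /= -> := coord_part0 (superbracket_part gP (hD _ _ gP')) kr.
  by rewrite mulr0 addr0.
exists (supercomponent D false), (supercomponent D true); split.
- exact: superderivation_gens (supercomponent_homogeneous _ _) (Dg _).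
- exact: superderivation_gens (supercomponent_homogeneous _ _) (Dg _).
exact: supercomponentD.
Qed.

(** * Linear forms in the matrix entries, and locality *)

Lemma coord_linear D x k : coord (D x) k = \sum_g coord x g * entry D (g, k).
Proof.
rewrite {1}(coord_expand x) linear_sum coord_sum; apply: eq_bigr => g _.
by rewrite linearZ coordZ.
Qed.

Definition form_value (f : schr_gen * schr_gen -> int) D : K :=
  dot (map f schr_pairs) (map (entry D) schr_pairs).

Lemma big_schr_gens (f : schr_gen -> K) : \sum_(g <- schr_gens) f g = \sum_g f g.
Proof.
have <- : enum {: schr_gen} = schr_gens by rewrite enumT unlock.
by rewrite big_enum.
Qed.

Lemma form_valueE f D :
  form_value f D = \sum_g \sum_k (f (g, k))%:~R * entry D (g, k).
Proof.
rewrite /form_value dot_map big_allpairs big_schr_gens; apply: eq_bigr => g _.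
exact: big_schr_gens.
Qed.

Lemma sum_delta g (f : schr_gen -> K) : \sum_h (h == g)%:R * f h = f g.
Proof.
rewrite (bigD1 g) //= eqxx mul1r big1 ?addr0 // => h /negPf ->.
exact: mul0r.
Qed.

Lemma leibniz_eqP D g g' k :
  leibniz_eq D g g' k <-> form_value (leibniz_form g g' k) D = 0.
Proof.
pose s : int := (-1) ^+ (schr_parity g
  && (schr_parity g (+) schr_parity g' (+) schr_parity k)).
have -> : form_value (leibniz_form g g' k) D =
    coord (D (schr_bracket (schr_vect K g) (schr_vect K g'))) k
    - coord (schr_bracket (D (schr_vect K g)) (schr_vect K g')) k
    - s%:~R * coord (schr_bracket (schr_vect K g) (D (schr_vect K g'))) k.
  rewrite form_valueE schr_bracket_vect coord_linear coord_bracketl coord_bracketr.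
  transitivity (\sum_h ((schr_struct g g' h)%:~R * entry D (h, k)
      - (h == g)%:R * \sum_m (schr_struct m g' k)%:~R * entry D (h, m)
      - (h == g')%:R * (s%:~R * \sum_m (schr_struct g m k)%:~R * entry D (h, m)))).
    (* A delta selecting [m = k] is inserted in the first term, so that all terms become sums over
       the same entries [(h, m)]. *)
    apply: eq_bigr => h _; rewrite -(sum_delta k (fun m => _ * entry D (h, m))).
    rewrite !mulr_sumr -!sumrB; apply: eq_bigr => m _.
    by rewrite /leibniz_form -/s /= !rmorphB !rmorphM /= -!pmulrn !mulrBl !mulrA.
  rewrite !sumrB !sum_delta; congr (_ - _ - _).
  by apply: eq_bigr => h _; rewrite coord_gen_bracket.
rewrite /leibniz_eq /s rmorph_sign -addrA -opprD.
by split=> [->|/eqP]; [rewrite subrr | rewrite subr_eq0 => /eqP].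
Qed.

Definition lincomb_vect (x : lincomb) : 'rV[K]_9 :=
  \sum_g (lincomb_coef x g)%:~R *: schr_vect K g.

(** This is where locality enters: the value of a test form depends on [D] only through its value at
    the one vector [lincomb_vect t.1]. *)
Lemma rank1_valueE t D : form_value (rank1_form t) D =
  \sum_k (lincomb_coef t.2 k)%:~R * coord (D (lincomb_vect t.1)) k.
Proof.
rewrite form_valueE exchange_big; apply: eq_bigr => k _.
rewrite linear_sum coord_sum mulr_sumr; apply: eq_bigr => g _.
by rewrite linearZ coordZ /rank1_form rmorphM mulrA [_%:~R * _]mulrC.
Qed.

Lemma superderivation_form_values D :
  superderivation D <->
  forall r, r \in leibniz_rows -> dot r (map (entry D) schr_pairs) = 0.
Proof.
split=> [DP _ /allpairsP[[[g g'] k] [_ _ ->]]|D0].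
  by apply/leibniz_eqP/superderivation_leibniz.
apply: leibniz_superderivation => g g' k; apply/leibniz_eqP/D0.
have all_gens h : h \in schr_gens by case: h.
exact: (allpairs_f (fun ab => leibniz_row ab.1 ab.2)
  (allpairs_f pair (all_gens g) (all_gens g')) (all_gens k)).
Qed.

Lemma local_superderivation_schr D : local_superderivation D -> superderivation D.
Proof.
move=> locD; apply/superderivation_form_values.
apply: entailsP tests_entail_leibniz _ => r r_test.
have [t _ rE] := mapP r_test.
have [D' D'P DE] := locD (lincomb_vect t.1).
(* At the test vector [D] may be exchanged for the super-derivation [D'], which satisfies every
   test. *)
rewrite rE -/(form_value _ _) rank1_valueE DE -rank1_valueE /form_value -rE.
apply: entailsP leibniz_entails_tests _ _ r_test.
exact/superderivation_form_values.
Qed.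

End Coordinates.

Theorem theorem3p1 (R : realType) (Delta : 'End(superSchroedinger R[i])) :
  local_superderivation Delta -> superderivation Delta.
Proof. exact: local_superderivation_schr. Qed.
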